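(* For every $k \geq 3$ and any $\delta > 0$, any deterministic anonymous strategyproof mechanism for $(\sqrt{2}-\delta)$-stable instances of $k$-Facility Location on the real line with $n \geq k+1$ agents has an unbounded approximation ratio; i.e., there is no $\rho$ (depending only on $n$ and $k$) such that the mechanism's social cost is at most $\rho$ times the optimal social cost on every $(\sqrt{2}-\delta)$-stable instance.
   Context: Agents $1,\ldots,n$ have private locations $\vec{x}=(x_1,\ldots,x_n)\in\mathbb{R}^n$; $d(x,y)=|x-y|$. A deterministic mechanism $M$ maps each instance to $k$ facility locations $M(\vec{x})\in\mathbb{R}^k$; agent $i$'s cost is $d(x_i,M(\vec{x}))=\min_l |x_i-M_l(\vec{x})|$ and the social cost is $\sum_i d(x_i,M(\vec{x}))$; the optimal social cost is $\min_{\vec{c}\in\mathbb{R}^k}\sum_i\min_l|x_i-c_l|$. $M$ is anonymous if its output depends only on the multiset of locations, not on agent identities. $M$ is strategyproof for $\gamma$-stable instances if for every $\gamma$-stable $\vec{x}$, every agent $i$ and every $y$ such that $(\vec{x}_{-i},y)$ (i.e. $\vec{x}$ with $x_i$ replaced by $y$) is $\gamma$-stable, $d(x_i,M(\vec{x}))\le d(x_i,M(\vec{x}_{-i},y))$. A clustering partitions the sorted locations into $k$ sets of consecutive locations; the optimal clustering is induced (nearest-facility assignment) by an optimal facility profile. A $\gamma$-perturbation of a sorted profile $\vec{x}$ ($\gamma\ge1$) is a sorted profile $\vec{x}'$ with $x'_1=x_1$ and $d(x_i,x_{i+1})/\gamma\le d(x'_i,x'_{i+1})\le d(x_i,x_{i+1})$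 for all $i\in[n-1]$; $\vec{x}$ is $\gamma$-stable if it has a unique optimal clustering and every $\gamma$-perturbation has the same unique optimal clustering (same cluster sizes in the same order). *)

(* Defs.v *)
From HB Require Import structures.
From mathcomp Require Import all_boot all_order all_algebra all_fingroup.
From mathcomp Require Import reals.
Set Implicit Arguments. Unset Strict Implicit. Unset Printing Implicit Defensive.
Import Order.TTheory GRing.Theory Num.Theory.
Local Open Scope ring_scope.

Section FacLoc.
Variables (R : realType) (n k : nat).

(* d(x, c) = min_l |x - c_l|.  The big min is seeded with the sum of all the
   distances, which is >= each distance, so for k >= 1 this is exactly the
   minimum over the k facilities. *)
Definition fdist (x : R) (c : 'I_k -> R) : R :=
  \big[Num.min/(\sum_(l < k) `|x - c l|)]_(l < k) `|x - c l|.

Definition social_cost (x : 'I_n -> R) (c : 'I_k -> R) : R :=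
  \sum_(i < n) fdist (x i) c.

Definition opt_profile (x : 'I_n -> R) (c : 'I_k -> R) : Prop :=
  forall c' : 'I_k -> R, social_cost x c <= social_cost x c'.

(* A clustering of a sorted profile into k sets of consecutive locations,
   given by the (positive) cluster sizes s_0, ..., s_{k-1} summing to n. *)
Definition clustering (s : 'I_k -> nat) : Prop :=
  (forall j, (0 < s j)%N) /\ (\sum_(j < k) s j)%N = n.

Definition in_block (s : 'I_k -> nat) (j : 'I_k) (i : 'I_n) : bool :=
  ((\sum_(l < k | (l < j)%N) s l)%N <= i)%N && (i < \sum_(l < k | (l <= j)%N) s l)%N.

Definition induced (y : 'I_n -> R) (s : 'I_k -> nat) (c : 'I_k -> R) : Prop :=
  exists sigma : {perm 'I_k},
    forall (j : 'I_k) (i : 'I_n), in_block s j i -> `|y i - c (sigma j)| = fdist (y i) c.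

Definition opt_clustering (y : 'I_n -> R) (s : 'I_k -> nat) : Prop :=
  clustering s /\ exists c, opt_profile y c /\ induced y s c.

Definition unique_opt_clustering (y : 'I_n -> R) (s : 'I_k -> nat) : Prop :=
  opt_clustering y s /\ forall s', opt_clustering y s' -> s' = s.

Definition sorted_profile (y : 'I_n -> R) : Prop :=
  forall i j : 'I_n, (i <= j)%N -> y i <= y j.

Definition perturbation (gamma : R) (y y' : 'I_n -> R) : Prop :=
  sorted_profile y' /\
  (forall i : 'I_n, nat_of_ord i = 0%N -> y' i = y i) /\
  (forall i j : 'I_n, nat_of_ord j = (nat_of_ord i).+1 ->
      (y j - y i) / gamma <= y' j - y' i /\ y' j - y' i <= y j - y i).

Definition stable_sorted (gamma : R) (y : 'I_n -> R) : Prop :=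
  exists s, unique_opt_clustering y s /\
    forall y', perturbation gamma y y' -> unique_opt_clustering y' s.

Definition stable (gamma : R) (x : 'I_n -> R) : Prop :=
  exists sigma : {perm 'I_n},
    sorted_profile (fun i => x (sigma i)) /\ stable_sorted gamma (fun i => x (sigma i)).

Definition mechanism := ('I_n -> R) -> ('I_k -> R).

Definition anonymous (M : mechanism) : Prop :=
  forall (sigma : {perm 'I_n}) (x : 'I_n -> R), M (fun i => x (sigma i)) = M x.

Definition replace (x : 'I_n -> R) (i : 'I_n) (y : R) : 'I_n -> R :=
  fun j => if j == i then y else x j.

Definition strategyproof_stable (gamma : R) (M : mechanism) : Prop :=
  forall (x : 'I_n -> R) (i : 'I_n) (y : R),
    stable gamma x -> stable gamma (replace x i y) ->
    fdist (x i) (M x) <= fdist (x i) (M (replace x i y)).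

Definition ratio_bounded_by (gamma : R) (M : mechanism) (rho : R) : Prop :=
  forall (x : 'I_n -> R), stable gamma x ->
    forall c, opt_profile x c -> social_cost x (M x) <= rho * social_cost x c.

End FacLoc.

(* Main.v *)
(* Fix all agents but two: k - 1 static positions far to the left, two of them at
   distance 1, and two movers s, t.  Such an instance is stable as soon as the gap
   |s - t| avoids [1/g, g], a window of ratio g^2 < 2.  Let F(s, t) be the set of
   facilities.  Strategyproofness says that the distance of a mover to F(s, t) is its
   distance to the union of all F(s', t); in particular z in F(s, t) implies
   z in F(z, t).

   If |s - t| is tiny, bounded approximation leaves a single facility for the movers; it
   lies in [s, t] and, by one-facility strategyproofness, either every tiny pair in some
   long interval omits its right mover, or every tiny pair there omits its left mover.
   In the first case let Om > 0 be the infimum of z - t over pairs t < z with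
   z in F(t, z); it is finite since a distant mover has a nearby facility.  Take such a
   pair with z - t close to Om and move z to some x in the right half of (t, z) such
   that (t, x) is stable: x slightly below z if Om > g, slightly above the midpoint
   otherwise; here g^2 < 2 is used.  The facility z' near x must lie beyond x, so
   (x, z') is a pair of the same kind that is shorter than Om, a contradiction.  The
   second case is the mirror image. *)

Require Import Defs.
From mathcomp Require Import all_boot all_order all_algebra all_fingroup.
From mathcomp Require Import boolp classical_sets reals.
From mathcomp Require Import lra zify.
Import Order.TTheory GRing.Theory Num.Theory.
Local Open Scope ring_scope.

Set Implicit Arguments.
Unset Strict Implicit.
Unset Printing Implicit Defensive.

(** * Two movers on the line *)

Section TwoAgents.
Variable R : realType.
Implicit Types (F : R -> R -> R -> Prop) (s t x y z lo hi g rho w : R).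

(* The remaining agents have a gap of length 1, so this says that [g] times the smaller
   of the two gaps is below the larger one. *)
Definition gap_ok g s t : Prop := g * `|s - t| < 1 \/ g < `|s - t|.

(** [F s t z] reads: [z] is a facility when the movers are at [s] and [t]. The existential compares
    distances to two facility sets without minima; [symmetric_rule] covers the second mover. *)
Definition sp_on g lo hi F : Prop := forall s s' t z',
  lo <= s <= hi -> lo <= s' <= hi -> lo <= t <= hi ->
  gap_ok g s t -> gap_ok g s' t -> F s' t z' ->
  exists2 z, F s t z & `|s - z| <= `|s - z'|.

Definition symmetric_rule F : Prop := forall s t z, F s t z -> F t s z.

Definition reflect_rule F s t z : Prop := F (- s) (- t) (- z).

Lemma gap_okN g s t : gap_ok g (- s) (- t) <-> gap_ok g s t.
Proof. by rewrite /gap_ok -opprD normrN. Qed.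

Lemma gap_okC g s t : gap_ok g s t <-> gap_ok g t s.
Proof. by rewrite /gap_ok distrC. Qed.

Lemma gap_ok_near g b s t :
  0 <= g -> g * b < 1 -> s <= t -> t - s <= b -> gap_ok g s t.
Proof.
move=> g0 gb st tsb; left; rewrite distrC ger0_norm ?subr_ge0 //.
exact: le_lt_trans (ler_wpM2l g0 tsb) gb.
Qed.

Lemma gap_ok_far g s t : s <= t -> g < t - s -> gap_ok g s t.
Proof. by move=> st h; right; rewrite distrC ger0_norm // subr_ge0. Qed.

Lemma sp_on_reflect g lo hi F :
  sp_on g lo hi F -> sp_on g (- hi) (- lo) (reflect_rule F).
Proof.
move=> sp s s' t z' hs hs' ht /gap_okN ok /gap_okN ok' Fz.
have [||| z Fzz le] := sp _ _ _ _ _ _ _ ok ok' Fz; try lra.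
exists (- z); first by rewrite /reflect_rule opprK.
have -> : s - - z = - (- s - z) by lra.
have -> : s - z' = - (- s - - z') by lra.
by rewrite !normrN.
Qed.

Lemma sym_reflect F : symmetric_rule F -> symmetric_rule (reflect_rule F).
Proof. by move=> sym s t z; apply: sym. Qed.

(** Induction along an interval in steps of length at most [e]; Archimedes bounds their number. *)
Lemma creep (P : R -> Prop) a b e : 0 < e -> P a ->
  (forall x y, a <= x -> x <= y -> y <= x + e -> y <= b -> P x -> P y) ->
  forall y, a <= y <= b -> P y.
Proof.
move=> e0 Pa step.
have ind m y : a <= y <= b -> y <= a + e *+ m -> P y.
  elim: m y => [|m IH] y /andP[ay yb] hy.
    have -> : y = a by move: hy; rewrite mulr0n; lra.
    exact: Pa.
  rewrite mulrS in hy.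
  have [le|gt] := lerP y (a + e *+ m); first by apply: IH => //; apply/andP.
  apply: (step (Num.max a (y - e))) => //.
  - by rewrite le_max lexx.
  - by rewrite ge_max ay; lra.
  - have : y - e <= Num.max a (y - e) by rewrite le_max lexx orbT.
    lra.
  - have [h|h] := leP a (y - e); last exact: Pa.
    apply: IH; lra.
move=> y ayb; apply: (ind (Num.bound ((y - a) / e))) => //.
have h : 0 <= (y - a) / e by rewrite divr_ge0 //; lra.
have := archi_boundP h; rewrite ltr_pdivrMr // mulr_natl => /ltW.
by rewrite lerBlDl.
Qed.

(** Reporting [s'] would give a mover at [z] distance 0, so the truth must do so too. *)
Lemma sp_on_exact g lo hi F s' t z :
  sp_on g lo hi F -> lo <= z <= hi -> lo <= s' <= hi -> lo <= t <= hi ->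
  gap_ok g z t -> gap_ok g s' t -> F s' t z -> F z t z.
Proof.
move=> sp hz hs' ht ok ok' Fz.
have [z1 Fz1] := sp _ _ _ _ hz hs' ht ok ok' Fz.
by rewrite subrr normr0 normr_le0 subr_eq0 => /eqP e; rewrite {2}e.
Qed.

Lemma no_close_exact_pairs_absurd g rho w lo hi F :
  1 <= g -> g * g < 2 -> 0 <= rho -> 0 < w ->
  lo + 4 * rho + 2 * g + 2 <= hi ->
  symmetric_rule F -> sp_on g lo hi F ->
  (forall s t, lo <= s <= hi -> lo <= t <= hi -> g < `|s - t| ->
     exists2 z, F s t z & `|s - z| <= rho) ->
  (forall t z, lo <= t -> z <= hi -> t < z -> z < t + w -> ~ F t z z) ->
  False.
Proof.
move=> g1 g2 rho0 w0 lohi sym sp far noclose.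
pose E t z := [/\ lo <= t, t < z, 2 * z - t <= hi, gap_ok g t z & F t z z].
pose A : set R := [set v | exists t z, E t z /\ v = z - t]%classic.
have A0 : (A !=set0)%classic.
  (* Any [z] within [rho] of [y] is more than [g] to the right of [lo], and [2 * z - lo] stays below
     [hi] by the assumed length of the interval. *)
  set y := lo + rho + g + 1.
  have hl : lo <= lo <= hi by lra.
  have hy : lo <= y <= hi by rewrite /y; lra.
  have fy : g < `|y - lo| by rewrite ger0_norm /y; lra.
  have [z Fz] := far y lo hy hl fy.
  rewrite ler_distlC => /andP[z1 z2].
  rewrite /y in z1 z2.
  have okz : gap_ok g lo z by apply: gap_ok_far; lra.
  exists (z - lo); exists lo, z; split => //; split => //; try lra.
  apply/sym; apply: (sp_on_exact sp _ hy hl _ _ Fz) => //; try lra.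
    exact/gap_okC.
  by right.
have lbw : lbound A w.
  move=> _ [t [z [[h1 h2 h3 _ Fz] ->]]].
  rewrite leNgt; apply/negP => h; apply: (noclose t z) => //; lra.
have hA : has_inf A by split => //; exists w.
set Om := inf A.
have Omw : w <= Om by apply: lb_le_inf.
have OmE t z : E t z -> Om <= z - t.
  by move=> Etz; apply: (ge_inf (proj2 hA)); exists t, z.
have close e : 0 < e -> exists t z, E t z /\ z - t < Om + e.
  move=> e0; have [_ [t [z [Etz ->]]] h] := inf_adherent e0 hA.
  by exists t, z.
(* Moving the far agent from [z] to [x] produces a facility near [x], hence an
   exact pair that is shorter than [(t, z)]. *)
have improve t z x : E t z -> t < x -> x < z -> z - x < x - t -> gap_ok g t x ->
    (exists z', [/\ x < z', z' <= z & gap_ok g x z' -> E x z']) \/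
    (exists z', [/\ 2 * x - z <= z', z' <= x & gap_ok g t z' -> E t z']).
  move=> [lot tz zhi ok Fz] tx xz zx okx.
  have ht : lo <= t <= hi by lra.
  have hx : lo <= x <= hi by lra.
  have hz : lo <= z <= hi by lra.
  have [||z' Fz'] := sp x z t z hx hz ht _ _ (sym _ _ _ Fz); try exact/gap_okC.
  rewrite [`|x - z|]ler0_norm ?ler_distlC; last by lra.
  move=> /andP[z'1 z'2].
  (* As [x] is in the right half, [z'] is to the right of [t]. If [z' <= x], the mover at [x] jumps
     onto [z']; otherwise the mover at [t] jumps over [x] onto [z']. *)
  have [lez'x|ltxz'] := lerP z' x; [right|left]; exists z'.
    split => //; first lra.
    move=> okz'; split => //; try lra.
    apply/sym; apply: (sp_on_exact sp _ hx ht _ _ Fz'); try exact/gap_okC; lra.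
  split => //; first lra.
  move=> okz'; split => //; try lra.
  apply/sym; apply: (sp_on_exact sp _ ht hx _ okx (sym _ _ _ Fz')).
    lra.
  exact/gap_okC.
have Om0 : 0 < Om by lra.
have [Omg|gOm] := lerP Om g.
  have g0 : 0 <= g by lra.
  (* [x] will be [t + Om / 2 + e]. From [Om <= g], [g * (Om / 2) <= g * g / 2 < 1] leaves room for
     [e]; both candidate pairs are then near and shorter than [Om]. *)
  have [e [e0 e1 e2]] : exists e, [/\ 0 < e, e < Om / 2 & g * (Om / 2 + e) < 1].
    exists (Num.min (Om / 4) ((2 - g * g) / 8)); split.
    - by rewrite lt_min; apply/andP; split; lra.
    - have : Num.min (Om / 4) ((2 - g * g) / 8) <= Om / 4 by rewrite ge_min lexx.
      lra.
    - set e := Num.min _ _.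
      have h1 : e <= (2 - g * g) / 8 by rewrite ge_min lexx orbT.
      nra.
  have [t [z [Etz zt]]] := close e e0.
  have Omz := OmE _ _ Etz.
  have [_ tz _ _ _] := Etz.
  have := improve t z (t + Om / 2 + e) Etz.
  case; try lra.
  - by apply: gap_ok_near e2 _ _; lra.
  - move=> [z' [z'1 z'2 Ez']].
    have /OmE : E (t + Om / 2 + e) z' by apply: Ez'; apply: gap_ok_near e2 _ _; lra.
    lra.
  - move=> [z' [z'1 z'2 Ez']].
    have /OmE : E t z' by apply: Ez'; apply: gap_ok_near e2 _ _; lra.
    lra.
have g0 : 0 <= g by lra.
(* [x] will be [t + Om - e]: then [z - x < 2 * e] is near, and a [z'] not beyond [x] has
   [z' - t > Om - 3 * e], still far. *)
have [e [e0 e1 e2]] : exists e, [/\ 0 < e, g < Om - 3 * e & g * (2 * e) < 1].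
  exists (Num.min ((Om - g) / 4) (1 / 8)); split.
  - by rewrite lt_min; apply/andP; split; lra.
  - have : Num.min ((Om - g) / 4) (1 / 8) <= (Om - g) / 4 by rewrite ge_min lexx.
    lra.
  - set e := Num.min _ _.
    have h1 : e <= 1 / 8 by rewrite ge_min lexx orbT.
    nra.
have [t [z [Etz zt]]] := close e e0.
have Omz := OmE _ _ Etz.
have := improve t z (t + Om - e) Etz.
case; try lra.
- by apply: gap_ok_far; lra.
- move=> [z' [z'1 z'2 Ez']].
  have /OmE : E (t + Om - e) z' by apply: Ez'; apply: gap_ok_near e2 _ _; lra.
  lra.
- move=> [z' [z'1 z'2 Ez']].
  have /OmE : E t z' by apply: Ez'; apply: gap_ok_far; lra.
  lra.
Qed.

(** The margin 1 keeps facilities meant for static agents out of the comparison; being two-sided, it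
    survives reflection. *)
Definition one_facility w lo hi F : Prop := forall s t,
  lo <= s -> t <= hi -> s <= t -> t < s + w ->
  (exists2 z, F s t z & s <= z <= t) /\
  (forall z z', F s t z -> F s t z' -> s - 1 <= z <= t + 1 ->
     s - 1 <= z' <= t + 1 -> z = z').

Lemma one_facility_reflect w lo hi F : symmetric_rule F ->
  one_facility w lo hi F -> one_facility w (- hi) (- lo) (reflect_rule F).
Proof.
move=> sym one s t hs ht st tw.
have [||||[z Fz hz] uniq] := one (- t) (- s); try lra.
split.
  by exists (- z); [rewrite /reflect_rule opprK; apply/sym | lra].
move=> z1 z2 /sym F1 /sym F2 h1 h2.
have : - z1 = - z2 by apply: uniq => //; lra.
lra.
Qed.

(** The right mover retreats in small steps. Truthfulness at its new place keeps the facility from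
    moving left of [z]; truthfulness at its old place keeps it from coming closer than [z]. *)
Lemma left_facility_persists g w lo hi F s y y' z :
  0 <= g -> w <= 1 -> g * w < 1 -> symmetric_rule F ->
  sp_on g lo hi F -> one_facility w lo hi F ->
  lo <= s -> y' <= hi -> y <= y' -> y' < s + w ->
  F s y z -> s <= z -> z < y -> F s y' z.
Proof.
move=> g0 w1 gw sym sp one los y'hi yy' y'w Fz sz zy.
have y_in : y <= y' <= y' by lra.
(* With steps of at most half of [y - z], a new facility beyond [x] would be closer to [x] than [z]
   is. *)
apply: (@creep (fun x => F s x z) y y' ((y - z) / 2)) y_in => //; first by lra.
move=> x x' yx xx' x'x x'y' Fx.
have okx : gap_ok g x s by apply/gap_okC; apply: gap_ok_near gw _ _; lra.
have okx' : gap_ok g x' s by apply/gap_okC; apply: gap_ok_near gw _ _; lra.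
have hs : lo <= s <= hi by lra.
have hx : lo <= x <= hi by lra.
have hx' : lo <= x' <= hi by lra.
have [||||_ uniq] := one s x; try lra.
have [||||[z' Fz' hz'] uniq'] := one s x'; try lra.
have [z1 /sym Fz1] := sp x' x s z hx' hx hs okx' okx (sym _ _ _ Fx).
rewrite [`|x' - z|]ger0_norm ?ler_distlC; last by lra.
move=> /andP[z1l z1r].
have ez1 : z1 = z' by apply: uniq' => //; lra.
have [z2 /sym Fz2 le2] := sp x x' s z' hx hx' hs okx okx' (sym _ _ _ Fz').
have le2' : `|x - z'| <= x - z by rewrite ler_distlC; lra.
have /andP[z2l z2r] : x - (x - z) <= z2 <= x + (x - z).
  by rewrite -ler_distlC; exact: le_trans le2'.
have ez2 : z2 = z by apply: uniq => //; lra.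
rewrite ez2 [`|x - z|]ger0_norm in le2; last by lra.
suff ez : z' = z by rewrite -ez.
by case: (lerP z' x) le2 => h le2; lra.
Qed.

Lemma right_facility_persists g w lo hi F s s' y z :
  0 <= g -> w <= 1 -> g * w < 1 -> symmetric_rule F ->
  sp_on g lo hi F -> one_facility w lo hi F ->
  lo <= s' -> y <= hi -> s' <= s -> y < s' + w ->
  F s y z -> s < z -> z <= y -> F s' y z.
Proof.
move=> g0 w1 gw sym sp one los' yhi s's yw Fz sz zy.
have h := @left_facility_persists g w (- hi) (- lo) (reflect_rule F)
  (- y) (- s) (- s') (- z) g0 w1 gw (sym_reflect sym) (sp_on_reflect sp)
  (one_facility_reflect sym one).
apply/sym; move: h; rewrite /reflect_rule !opprK; apply; try lra.
exact: sym.
Qed.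

Lemma no_two_agent_rule g rho w B F :
  1 <= g -> g * g < 2 -> 0 <= rho -> 0 < w -> w <= 1 -> g * w < 1 ->
  symmetric_rule F ->
  (forall hi, sp_on g B hi F) ->
  (forall s, B <= s -> F s s s) ->
  (forall s t, B <= s -> B <= t -> g < `|s - t| ->
     exists2 z, F s t z & `|s - z| <= rho) ->
  (forall s t z z', B <= s -> s <= t -> t < s + w ->
     F s t z -> F s t z' -> B - 1 <= z -> B - 1 <= z' -> z = z') ->
  False.
Proof.
move=> g1 g2 rho0 w0 w1 gw sym sp diag far uniq.
have g0 : 0 <= g by lra.
have near_ok s t : s <= t -> t < s + w -> gap_ok g s t.
  by move=> st tw; apply: gap_ok_near gw _ _; lra.
have one hi : one_facility w B hi F.
  move=> s t Bs thi st tw; split; last first.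
    by move=> z z' Fz Fz' hz hz'; apply: (uniq s t) => //; lra.
  have hs : B <= s <= t by lra.
  have ht : B <= t <= t by lra.
  have okd x : gap_ok g x x by left; rewrite subrr normr0 mulr0 ltr01.
  have ok := near_ok s t st tw.
  have ok' : gap_ok g t s by exact/gap_okC.
  (* Either mover could join the other, where [diag] gives a facility, so each has one within
     [t - s]. Uniqueness makes it the same one, hence it lies between them. *)
  have [z Fz] := sp t s t t t hs ht ht ok (okd t) (diag t ltac:(lra)).
  rewrite [`|s - t|]ler0_norm ?ler_distlC; last by lra.
  move=> /andP[zl zr].
  have [z' /sym Fz'] := sp t t s s s ht hs hs ok' (okd s) (diag s Bs).
  rewrite [`|t - s|]ger0_norm ?ler_distlC; last by lra.
  move=> /andP[z'l z'r].
  have e : z = z' by apply: (uniq s t) => //; lra.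
  by exists z => //; lra.
set H := 4 * rho + 2 * g + 2.
(* If close pairs always have the facility on the right mover, uniqueness keeps it off the left one,
   and the mirrored rule has no close exact pair. *)
have [allright|] := pselect (forall c d, B <= c -> c < d -> d < c + w -> F c d d).
  apply: (@no_close_exact_pairs_absurd g rho w (- (B + H)) (- B) (reflect_rule F)) => //.
  - by rewrite /H; lra.
  - exact: sym_reflect.
  - exact/sp_on_reflect/sp.
  - move=> s t hs ht.
    have -> : s - t = - (- s - - t) by lra.
    rewrite normrN => gst.
    have [||z Fz le] := far (- s) (- t) _ _ gst; try lra.
    exists (- z); first by rewrite /reflect_rule opprK.
    have -> : s - - z = - (- s - z) by lra.
    by rewrite normrN.
  - move=> t z tl zr tz zt /sym Fz.
    have Ft : F (- z) (- t) (- t) by apply: allright; lra.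
    have : - z = - t by apply: (uniq (- z) (- t)) => //; lra.
    lra.
move=> /existsNP[c /existsNP[d]].
move=> /not_implyP[Bc /not_implyP[cd /not_implyP[dw nF]]].
(* Otherwise some close pair has its facility [p] before its right end; moving the left mover onto
   [p] puts the facility on the left mover. *)
have [||||[p Fp hp] _] := one d c d; try lra.
have pd : p < d.
  by rewrite lt_neqAle; apply/andP; split; [apply/eqP => e; apply: nF; rewrite -{2}e | lra].
have Fpd : F p d p.
  apply: (@sp_on_exact g B d F c) => //; try lra; apply: near_ok; lra.
pose Q t := forall y, t < y -> y < t + w -> F t y t.
(* One partner [y] suffices: farther ones follow by persistence, and with a nearer [y'] a facility
   right of [t] would tempt the mover at [y] to report [y']. *)
have QI t y : B <= t -> t < y -> y < t + w -> F t y t -> Q t.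
  move=> Bt ty yw Ft y' ty' y'w.
  have [yy'|y'y] := lerP y y'.
    by apply: (@left_facility_persists g w B y' F t y y' t) => //; lra.
  have [||||[z' Fz' hz'] _] := one y' t y'; try lra.
  have [|||||z1 /sym Fz1] := sp y y y' t z' _ _ _ _ _ (sym _ _ _ Fz'); try lra.
  - by apply/gap_okC/near_ok; lra.
  - by apply/gap_okC/near_ok; lra.
  rewrite [`|y - z'|]ger0_norm; last by lra.
  move=> le; have := le; rewrite ler_distlC => /andP[z1l z1r].
  have e : z1 = t by apply: (uniq t y) => //; lra.
  move: le; rewrite e ger0_norm; last by lra.
  move=> le; have e' : z' = t by lra.
  by rewrite e' in Fz'.
have Qall : forall t, p <= t <= p + H -> Q t.
  (* Steps of [w / 2] keep the test partner [t' + w / 4] within [w] of [t]. A facility right of [t']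
     would survive moving the left mover back to [t], against [Q t]. *)
  apply: (@creep Q p (p + H) (w / 2)); first by lra.
    by apply: (QI p d) => //; lra.
  move=> t t' pt tt' t'w t'H Qt.
  have [e|/eqP ne] := eqVneq t t'; first by rewrite -e.
  apply: (QI t' (t' + w / 4)); try lra.
  have [||||[z Fz hz] _] := one (t' + w / 4) t' (t' + w / 4); try lra.
  have [e|ne'] := eqVneq z t'; first by rewrite e in Fz.
  have zt' : t' < z by rewrite lt_neqAle eq_sym ne'; lra.
  have Fz' : F t (t' + w / 4) z.
    by apply: (@right_facility_persists g w B (t' + w / 4) F t' t) => //; lra.
  have Ft : F t (t' + w / 4) t by apply: Qt; lra.
  have : z = t by apply: (uniq t (t' + w / 4)) => //; lra.
  lra.
apply: (@no_close_exact_pairs_absurd g rho w p (p + H) F) => //.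
- by rewrite /H; lra.
- by move=> s s' t z' hs hs' ht; apply: (sp (p + H)); lra.
- by move=> s t hs ht; apply: far; lra.
- move=> t z pt zH tz zw Fz.
  have Ft : F t z t by apply: Qall => //; lra.
  have : z = t by apply: (uniq t z) => //; lra.
  lra.
Qed.

End TwoAgents.

(** * Distances, blocks and profiles with one smallest gap *)

Section Fdist.
Variables (R : realType) (k : nat).
Implicit Types (x : R) (c : 'I_k -> R).

Lemma fdist_le x c l : fdist x c <= `|x - c l|.
Proof. by rewrite /fdist (bigD1 l) //= ge_min lexx. Qed.

Lemma fdist_ge0 x c : 0 <= fdist x c.
Proof.
rewrite /fdist; elim/big_ind: _ => //.
- by apply: sumr_ge0.
- by move=> a b a0 b0; rewrite le_min a0.
Qed.

Lemma fdist_attained x c : (0 < k)%N -> exists l, fdist x c = `|x - c l|.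
Proof.
move=> k0; pose l0 := Ordinal k0.
have [l _ lmin] := arg_minP (fun l => `|x - c l|) (isT : predT l0).
exists l; apply/le_anti; rewrite fdist_le /=.
rewrite /fdist; elim/big_ind: _ => //.
- by rewrite (bigD1 l) //= lerDl sumr_ge0.
- by move=> a b ha hb; rewrite le_min ha.
Qed.

Lemma fdist_le_cost n (x : 'I_n -> R) c i : fdist (x i) c <= social_cost x c.
Proof.
rewrite /social_cost (bigD1 i) //= lerDl sumr_ge0 // => j _; exact: fdist_ge0.
Qed.

Lemma shared_facility_cost n (x : 'I_n -> R) c l (i j : 'I_n) : i != j ->
  `|x i - c l| = fdist (x i) c -> `|x j - c l| = fdist (x j) c ->
  `|x i - x j| <= social_cost x c.
Proof.
move=> ij ei ej; rewrite /social_cost (bigD1 i) //= (bigD1 j) 1?eq_sym //=.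
rewrite addrA -ei -ej; apply: ler_wpDr; first by apply: sumr_ge0 => *; exact: fdist_ge0.
rewrite [`|x j - _|]distrC.
have -> : x i - x j = (x i - c l) + (c l - x j) by lra.
exact: ler_normD.
Qed.

End Fdist.

(** * Block boundaries of a clustering *)

Section Blocks.
Variables (n k : nat).
Implicit Types (s : 'I_k -> nat) (i : 'I_n).

Definition psum s (j : nat) : nat := \sum_(l < k | (l < j)%N) s l.

Lemma in_blockE s (j : 'I_k) i :
  in_block s j i = (psum s j <= i < psum s j.+1)%N.
Proof. by []. Qed.

Lemma psum0 s : psum s 0 = 0%N.
Proof. by rewrite /psum big_pred0. Qed.

Lemma psumS s (j : 'I_k) : psum s j.+1 = (psum s j + s j)%N.
Proof.
rewrite /psum (bigD1 j) //= addnC; congr (_ + _)%N; apply: eq_bigl => l.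
rewrite -val_eqE /=; lia.
Qed.

Lemma psum_all s : psum s k = (\sum_(l < k) s l)%N.
Proof. by rewrite /psum; apply: eq_bigl => l; rewrite ltn_ord. Qed.

Lemma psum_mono s (a b : nat) : (a <= b)%N -> (psum s a <= psum s b)%N.
Proof.
move=> ab; rewrite /psum [X in (_ <= X)%N](bigID (fun l : 'I_k => (l < a)%N)) /=.
rewrite [X in (_ <= X + _)%N](eq_bigl (fun l : 'I_k => (l < a)%N)) ?leq_addr //.
move=> l /=; lia.
Qed.

Lemma in_block_ex s i : clustering n s -> exists j, in_block s j i.
Proof.
move=> [_ tot].
have ex : exists j, (i < psum s j)%N by exists k; rewrite psum_all tot.
case: (ex_minnP ex) => -[|j] hj jmin; first by rewrite psum0 in hj.
have jk : (j < k)%N.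
  by rewrite ltnNge; apply/negP => kj; have := jmin k; rewrite psum_all tot ltn_ord; lia.
exists (Ordinal jk); rewrite in_blockE /= hj andbT leqNgt.
by apply/negP => /jmin; rewrite ltnn.
Qed.

Lemma in_block_mono s (j j' : 'I_k) (i i' : 'I_n) :
  in_block s j i -> in_block s j' i' -> (i <= i')%N -> (j <= j')%N.
Proof.
rewrite !in_blockE => /andP[h1 h2] /andP[h3 h4] ii'.
rewrite leqNgt; apply/negP => jj'; have := psum_mono s jj'; lia.
Qed.

(** Boundaries agree by induction: at a first disagreement, the agent indexed by the smaller one is
    in the block for only one of the two. *)
Lemma in_block_inj s s' : clustering n s -> clustering n s' ->
  (forall j i, in_block s j i = in_block s' j i) -> s = s'.
Proof.
move=> cs cs' E.
have P a : (a <= k)%N -> psum s a = psum s' a.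
  elim: a => [|a IH] ak; first by rewrite !psum0.
  have {}IH := IH (ltnW ak).
  have le u u' : clustering n u -> clustering n u' ->
      (forall j i, in_block u j i = in_block u' j i) ->
      psum u a = psum u' a -> (psum u a.+1 <= psum u' a.+1)%N.
    move=> [_ cu] _ Eu ea; pose ja := Ordinal ak.
    rewrite leqNgt; apply/negP => lt.
    have ltn_ : (psum u' a.+1 < n)%N.
      by apply: leq_trans lt _; rewrite -cu -psum_all psum_mono.
    have := Eu ja (Ordinal ltn_); rewrite !in_blockE /= ltnn andbF lt andbT.
    by rewrite ea psum_mono.
  by apply/eqP; rewrite eqn_leq !le.
apply/funext => j; have := P j.+1 (ltn_ord j); rewrite !psumS (P j (ltnW (ltn_ord j))).
exact: addnI.
Qed.

End Blocks.

Lemma nondecreasing_upto (R : realType) (q : nat -> R) k :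
  (forall j, (j < k)%N -> q j <= q j.+1) ->
  forall i j, (i <= j <= k)%N -> q i <= q j.
Proof.
move=> qS i j; elim: j => [|j IH] hij; first by have -> : i = 0%N by lia.
have [->|ne] := eqVneq i j.+1; first by [].
by apply: le_trans (IH _) (qS j _); lia.
Qed.

(* A profile with [k.+1] positions [q 0 <= ... <= q k]: by truncated subtraction the
   first [h.+1] agents share the position [q 0]. *)
Definition spread (R : realType) (h k : nat) (q : nat -> R) : 'I_(h + k).+1 -> R :=
  fun i => q (i - h)%N.

Definition rep (h k j : nat) : 'I_(h + k).+1 := inord (h + j).

Lemma repE h k j : (j <= k)%N -> rep h k j = (h + j)%N :> nat.
Proof. by move=> jk; rewrite /rep inordK //; lia. Qed.

Lemma spread_rep (R : realType) h k (q : nat -> R) j :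
  (j <= k)%N -> spread q (rep h k j) = q j.
Proof. by move=> jk; rewrite /spread repE // addKn. Qed.

(** * The optimal clustering when one gap is strictly smallest *)

Section MinGap.
Variables (R : realType) (h k m : nat) (q : nat -> R).
Hypotheses (m_gt0 : (0 < m)%N) (m_le : (m <= k)%N).
Hypothesis gap_ge0 : 0 <= q m - q m.-1.
Hypothesis gap_min : forall j, (0 < j <= k)%N -> j != m ->
  q m - q m.-1 < q j - q j.-1.

Local Notation n := (h + k).+1.
Local Notation y := (@spread R h k q).
Local Notation rep := (rep h k).

Let k_gt0 : (0 < k)%N. Proof. lia. Qed.

Let gap_le j : (j < k)%N -> q m - q m.-1 <= q j.+1 - q j.
Proof.
move=> jk; have [->|jm] := eqVneq m j.+1; first by [].
by apply/ltW/gap_min; rewrite 1?eq_sym.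
Qed.

Let q_mono i j : (i <= j <= k)%N -> q i <= q j.
Proof.
apply: nondecreasing_upto => a /gap_le; have := gap_ge0; lra.
Qed.

Let q_gap i j : (i < j <= k)%N -> q m - q m.-1 <= q j - q i.
Proof.
move=> hij; have h1 : q m - q m.-1 <= q i.+1 - q i by apply: gap_le; lia.
have h2 : q i.+1 <= q j by apply: q_mono; lia.
lra.
Qed.

(** Pigeonhole: two of the [k.+1] positions share a nearest facility. *)
Lemma social_cost_ge_mingap (c : 'I_k -> R) : q m - q m.-1 <= social_cost y c.
Proof.
have ex (j : 'I_k.+1) : exists l, fdist (y (rep j)) c == `|y (rep j) - c l|.
  by have [l e] := fdist_attained (y (rep j)) c k_gt0; exists l; apply/eqP.
pose phi j := xchoose (ex j).
have phiP (j : 'I_k.+1) : `|y (rep j) - c (phi j)| = fdist (y (rep j)) c.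
  by have /eqP := xchooseP (ex j).
have /injectivePn[i [j ij e]] : ~~ injectiveb phi.
  apply/negP => /injectiveP /leq_card; rewrite !card_ord; lia.
wlog lt : i j ij e / (i < j)%N.
  move=> H; have [lt|gt|eq] := ltngtP i j; first exact: (H i j).
    by apply: (H j i) => //; rewrite eq_sym.
  by move: ij; rewrite (val_inj eq) eqxx.
have ji : (j <= k)%N by rewrite -ltnS.
have ik : (i <= k)%N by rewrite -ltnS.
have rij : rep i != rep j by rewrite -val_eqE /= !repE //; lia.
have := shared_facility_cost rij (phiP i).
rewrite e => /(_ (phiP j)); rewrite !spread_rep // distrC.
have g1 : q m - q m.-1 <= q j - q i by apply: q_gap; lia.
apply: le_trans; apply: le_trans g1 _; exact: ler_norm.
Qed.

(** [bump m] runs over all indices but [m]. As [m] is positive, a single agent has index [m], and it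
    can be served from [q m.-1]. *)
Definition skip_profile : 'I_k -> R := fun l => q (bump m l).

Let skip_fdist0 (i : 'I_n) : (i - h)%N != m -> fdist (y i) skip_profile = 0.
Proof.
move=> im; apply/le_anti; rewrite fdist_ge0 andbT.
have lt : (unbump m (i - h) < k)%N.
  by have := ltn_ord i; move: im; rewrite /unbump; lia.
apply: le_trans (fdist_le _ _ (Ordinal lt)) _.
by rewrite /skip_profile /= unbumpK //= /spread subrr normr0.
Qed.

Let skip_cost : social_cost y skip_profile = fdist (q m) skip_profile.
Proof.
rewrite /social_cost (bigD1 (rep m)) //= spread_rep // big1 ?addr0 // => i im.
apply: skip_fdist0; apply: contraNN im => /eqP e.
by rewrite -val_eqE /= repE //; lia.
Qed.

Let skip_le : fdist (q m) skip_profile <= q m - q m.-1.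
Proof.
have lt : (m.-1 < k)%N by lia.
apply: le_trans (fdist_le _ _ (Ordinal lt)) _.
rewrite /skip_profile /= /bump leqNgt prednK // leqnn /= add0n.
by rewrite ger0_norm.
Qed.

Lemma social_cost_skip : social_cost y skip_profile = q m - q m.-1.
Proof.
by apply/le_anti; rewrite social_cost_ge_mingap skip_cost skip_le.
Qed.

Lemma opt_skip : opt_profile y skip_profile.
Proof. by move=> c; rewrite social_cost_skip; exact: social_cost_ge_mingap. Qed.

(** Block 0 gets the [h] extra agents at [q 0], block [m.-1] both ends of the smallest gap; thus
    [unbump m.-1] sends a position index to its block. *)
Definition mingap_sizes : 'I_k -> nat :=
  fun j => (1 + (j == 0%N :> nat) * h + (j == m.-1 :> nat))%N.

Let psum_sizes j : (j <= k)%N ->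
  psum mingap_sizes j = (j + (0 < j) * h + (m.-1 < j))%N.
Proof.
elim: j => [|j IH] jk; first by rewrite psum0.
have := psumS mingap_sizes (Ordinal jk); rewrite /= => ->.
rewrite IH; last exact: ltnW.
rewrite /mingap_sizes /=.
case: j {IH jk} => [|j] /=; rewrite ?mul1n ?mul0n; lia.
Qed.

Let in_block_sizes (j : 'I_k) (i : 'I_n) :
  in_block mingap_sizes j i = (unbump m.-1 (i - h) == j).
Proof.
have jk := ltn_ord j; have hi := ltn_ord i;
rewrite in_blockE (psum_sizes (ltnW jk)) (psum_sizes jk).
rewrite /unbump; case: (nat_of_ord j) jk => [|j'] jk /=; rewrite ?mul1n ?mul0n; lia.
Qed.

Let clustering_sizes : clustering n mingap_sizes.
Proof.
split=> [j|]; first by rewrite /mingap_sizes; lia.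
by rewrite -psum_all psum_sizes // k_gt0 mul1n; lia.
Qed.

Lemma opt_clustering_sizes : opt_clustering y mingap_sizes.
Proof.
split; first exact: clustering_sizes.
exists skip_profile; split; first exact: opt_skip.
exists 1%g => j i; rewrite perm1 in_block_sizes => /eqP e.
rewrite /skip_profile -e.
have [im|im] := eqVneq (i - h)%N m.
  have ei : y i = q m by rewrite /spread im.
  rewrite ei im; have -> : bump m (unbump m.-1 m) = m.-1.
    by rewrite /bump /unbump; lia.
  rewrite ger0_norm //; apply/le_anti; rewrite skip_le andbT.
  by rewrite -skip_cost social_cost_ge_mingap.
have -> : bump m (unbump m.-1 (i - h)) = (i - h)%N.
  by move: im; rewrite /bump /unbump; lia.
by rewrite skip_fdist0 // /spread subrr normr0.
Qed.

(** Every other gap exceeds the optimal cost, so its ends lie in different blocks. These [k - 1]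
    strict increases among [k] block numbers determine them all. *)
Lemma opt_clustering_unique s : opt_clustering y s -> s = mingap_sizes.
Proof.
move=> [cs [c [copt [sigma ind]]]].
apply: (in_block_inj cs clustering_sizes) => j i; rewrite in_block_sizes.
have ex (i' : 'I_n) : exists j, in_block s j i' by apply: in_block_ex.
pose b i' : 'I_k := xchoose (ex i').
have bP i' : in_block s (b i') i' := xchooseP (ex i').
have cost_le : social_cost y c <= q m - q m.-1.
  by rewrite -social_cost_skip; exact: copt.
have bmono (i1 i2 : 'I_n) : (i1 <= i2)%N -> (b i1 <= b i2)%N.
  exact: in_block_mono (bP i1) (bP i2).
have bstep a : (a < k)%N -> a.+1 != m -> (b (rep a) < b (rep a.+1))%N.
  move=> ak am; rewrite ltn_neqAle bmono ?repE ?andbT; try lia.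
  apply/eqP => /val_inj e.
  have ra : rep a.+1 != rep a by rewrite -val_eqE /= !repE //; lia.
  have e1 := ind _ _ (bP (rep a.+1)); have e2 := ind _ _ (bP (rep a)).
  rewrite -e in e1; have := shared_facility_cost ra e1 e2.
  rewrite !spread_rep //; last exact: ltnW.
  have := gap_min (j := a.+1) ltac:(lia) am; rewrite /=.
  have := ler_norm (q a.+1 - q a); lra.
(* [blow] counts increases from the left and [bup] from the right; the booleans allow for a missing
   increase at [m]. *)
have blow a : (a <= k)%N -> (b (rep 0) + a <= b (rep a) + (m <= a))%N.
  elim: a => [|a IH] ak; first by lia.
  have {}IH := IH (ltnW ak).
  have [e|ne] := eqVneq a.+1 m; last by have := bstep a ak ne; lia.
  have : (b (rep a) <= b (rep a.+1))%N by apply: bmono; rewrite !repE; lia.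
  lia.
have bup d a : (a + d = k)%N -> (b (rep a) + d <= b (rep k) + (a < m))%N.
  elim: d a => [|d IH] a ad; first by rewrite addn0 in ad; rewrite ad; lia.
  have {}IH := IH a.+1 ltac:(lia).
  have ak : (a < k)%N by lia.
  have [e|ne] := eqVneq a.+1 m; last by have := bstep a ak ne; lia.
  have : (b (rep a) <= b (rep a.+1))%N by apply: bmono; rewrite !repE; lia.
  lia.
have bk : (b (rep k) < k)%N by apply: ltn_ord.
have hi := ltn_ord i.
have bi : b i = unbump m.-1 (i - h) :> nat.
  have b0 := blow k (leqnn k).
  have [ih|hi'] := leqP i h.
    have : (b i <= b (rep 0))%N by apply: bmono; rewrite repE //; lia.
    rewrite /unbump; lia.
  have ei : i = rep (i - h) by apply: ord_inj; rewrite repE; lia.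
  have := blow (i - h)%N ltac:(lia); have := bup (k - (i - h))%N (i - h)%N ltac:(lia).
  rewrite -ei /unbump; lia.
rewrite -bi; apply/idP/eqP => [jb|/val_inj <-]; last exact: bP.
apply/eqP; rewrite eqn_leq.
by rewrite (in_block_mono (bP i) jb) ?(in_block_mono jb (bP i)).
Qed.

Lemma mingap_unique_opt : unique_opt_clustering y mingap_sizes.
Proof. split; [exact: opt_clustering_sizes | exact: opt_clustering_unique]. Qed.

End MinGap.

(** A perturbation never enlarges the gap at [m] and divides the others by at most [g], so that gap
    stays strictly smallest. *)
Lemma stable_sorted_mingap (R : realType) (g : R) h k m (q : nat -> R) :
  1 <= g -> (0 < m <= k)%N -> 0 <= q m - q m.-1 ->
  (forall j, (0 < j <= k)%N -> j != m -> g * (q m - q m.-1) < q j - q j.-1) ->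
  stable_sorted k g (@spread R h k q).
Proof.
move=> g1 /andP[m0 mk] gap0 gapmin.
exists (mingap_sizes h m); split.
  apply: mingap_unique_opt => // j jk jm; apply: le_lt_trans (gapmin j jk jm).
  by rewrite ler_peMl.
move=> y' [_ [_ pert]].
have g0 : 0 < g by lra.
pose q' j := y' (rep h k j).
(* Zero gaps remain zero, so the agents at [q 0] stay together and [y'] is again a [spread]. *)
have y'0 a : (a <= h)%N -> y' (inord (h - a)) = q' 0%N.
  elim: a => [|a IH] ah; first by rewrite /q' /rep addn0 subn0.
  rewrite -IH; last exact: ltnW.
  have v1 : (inord (h - a) : 'I_(h + k).+1) = (h - a)%N :> nat by rewrite inordK //; lia.
  have v2 : (inord (h - a.+1) : 'I_(h + k).+1) = (h - a.+1)%N :> nat.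
    by rewrite inordK //; lia.
  have [|] := pert (inord (h - a.+1)) (inord (h - a)); first by rewrite v1 v2; lia.
  rewrite /spread v1 v2.
  have -> : (h - a - h = 0)%N by lia.
  have -> : (h - a.+1 - h = 0)%N by lia.
  rewrite subrr mul0r; lra.
have -> : y' = spread q'.
  apply: funext => i; rewrite /spread /q' /rep.
  have [ih|hi] := leqP i h.
    have -> : (i - h = 0)%N by lia.
    rewrite -/(rep h k 0) -/(q' 0%N) -(y'0 (h - i)%N (leq_subr _ _)) subKn //.
    by rewrite inord_val.
  by rewrite subnKC ?inord_val // ltnW.
have gap j : (0 < j <= k)%N ->
    (q j - q j.-1) / g <= q' j - q' j.-1 /\ q' j - q' j.-1 <= q j - q j.-1.
  move=> jk; have [] := pert (rep h k j.-1) (rep h k j).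
    by rewrite !repE; lia.
  by rewrite !spread_rep; try lia.
apply: mingap_unique_opt => //.
  have [|lo _] := gap m; first by apply/andP.
  have : 0 <= (q m - q m.-1) / g by rewrite divr_ge0 // ltW.
  lra.
move=> j jk jm; have [lo _] := gap j jk; apply: lt_le_trans lo.
have [|_ up] := gap m; first by apply/andP.
apply: le_lt_trans up _; rewrite ltr_pdivlMr // mulrC; exact: gapmin.
Qed.

Lemma stable_mingap (R : realType) (g : R) h k m (q : nat -> R) :
  1 <= g -> (0 < m <= k)%N -> 0 <= q m - q m.-1 ->
  (forall j, (0 < j <= k)%N -> j != m -> g * (q m - q m.-1) < q j - q j.-1) ->
  stable k g (@spread R h k q).
Proof.
move=> g1 mk gap0 gapmin; exists 1%g.
have -> : (fun i => @spread R h k q ((1%g : {perm _}) i)) = spread q.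
  by apply: funext => i; rewrite perm1.
split; last exact: stable_sorted_mingap gapmin.
move=> i j ij; apply: (@nondecreasing_upto R q k); last by have := ltn_ord j; lia.
move=> a ak; rewrite -subr_ge0.
have [e|ne] := eqVneq m a.+1; first by rewrite e in gap0.
apply: le_trans (ltW (gapmin a.+1 _ _)); last by rewrite eq_sym.
  by apply: mulr_ge0 => //; lra.
by [].
Qed.

Lemma stable_perm (R : realType) n k (g : R) (x : 'I_n -> R) (tau : {perm 'I_n}) :
  @stable R n k g x -> @stable R n k g (fun i => x (tau i)).
Proof.
move=> [sigma [so st]]; exists (sigma * tau^-1)%g.
have -> : (fun i => x (tau ((sigma * tau^-1)%g i))) = (fun i => x (sigma i)).
  by apply: funext => i; rewrite permM permKV.
by [].
Qed.

(** * The instances with two movers *)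

Section TwoMovers.
Variables (R : realType) (h k : nat).
Implicit Types (s t : R).

(* Static positions 0, 1, 3, 5, ..., with exactly one gap of length 1, followed by the
   positions [s] and [t] of the two movers. *)
Definition pos s t j : R :=
  if j == k.+2 then s else if j == k.+3 then t else (j.*2.-1)%:R.

(** Two units beyond the last static position [2 * k + 1]. *)
Definition base : R := (k.*2 + 3)%:R.

Definition two_movers s t : 'I_(h + k.+3).+1 -> R := spread (pos s t).

Lemma pos_static s t j : (j < k.+2)%N -> pos s t j = (j.*2.-1)%:R.
Proof. by move=> jk; rewrite /pos !ifN //; lia. Qed.

Lemma static_le_base j : (j < k.+2)%N -> (j.*2.-1)%:R + 2 <= base.
Proof. by move=> jk; rewrite /base -natrD ler_nat; lia. Qed.

Lemma pos_gap1 s t : pos s t 1 - pos s t 0 = 1.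
Proof. by rewrite !pos_static // subr0. Qed.

Lemma pos_gap_movers s t : pos s t k.+3 - pos s t k.+2 = t - s.
Proof. by rewrite /pos eqxx ifN ?eqxx //; lia. Qed.

Lemma pos_gap_ge2 s t j : base <= s -> (1 < j < k.+3)%N ->
  2 <= pos s t j - pos s t j.-1.
Proof.
rewrite /base => Bs hj; rewrite (@pos_static s t j.-1); last by lia.
rewrite lerBrDl -natrD; have [ej|nj] := eqVneq j k.+2.
  rewrite /pos ej eqxx; apply: le_trans Bs; rewrite ler_nat; lia.
by rewrite pos_static ?ler_nat; lia.
Qed.

Lemma pos_mingap_near g s t j : 1 <= g -> base <= s -> g * (t - s) < 1 ->
  (0 < j <= k.+3)%N -> j != k.+3 ->
  g * (pos s t k.+3 - pos s t k.+2) < pos s t j - pos s t j.-1.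
Proof.
move=> g1 Bs gts hj jn; rewrite pos_gap_movers.
have [->|j1] := eqVneq j 1%N; first by rewrite pos_gap1.
have := @pos_gap_ge2 s t j Bs ltac:(lia); lra.
Qed.

Lemma pos_mingap_far g s t j : g < 2 -> base <= s -> g < t - s ->
  (0 < j <= k.+3)%N -> j != 1%N ->
  g * (pos s t 1 - pos s t 0) < pos s t j - pos s t j.-1.
Proof.
move=> g2 Bs gts hj j1; rewrite pos_gap1 mulr1.
have [->|jn] := eqVneq j k.+3; first by rewrite pos_gap_movers.
have := @pos_gap_ge2 s t j Bs ltac:(lia); lra.
Qed.

Definition mover1 : 'I_(h + k.+3).+1 := rep h k.+3 k.+2.
Definition mover2 : 'I_(h + k.+3).+1 := rep h k.+3 k.+3.

Lemma two_movers1 s t : two_movers s t mover1 = s.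
Proof. by rewrite /two_movers spread_rep // /pos eqxx. Qed.

Lemma two_movers2 s t : two_movers s t mover2 = t.
Proof. by rewrite /two_movers spread_rep // /pos eqxx ifN //; lia. Qed.

Lemma two_movers_static s t s' t' i :
  i != mover1 -> i != mover2 -> two_movers s t i = two_movers s' t' i.
Proof.
move=> i1 i2; rewrite /two_movers /spread /pos.
have h1 : (i - h)%N != k.+2.
  apply: contraNN i1 => /eqP e; apply/eqP/ord_inj; rewrite repE //; lia.
have h2 : (i - h)%N != k.+3.
  apply: contraNN i2 => /eqP e; apply/eqP/ord_inj; rewrite repE //; lia.
by rewrite !(negPf h1) !(negPf h2).
Qed.

Lemma two_movers_swap s t :
  (fun i => two_movers s t (tperm mover1 mover2 i)) = two_movers t s.
Proof.
apply: funext => i; case: tpermP => [->|->|/eqP i1 /eqP i2].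
- by rewrite two_movers1 two_movers2.
- by rewrite two_movers1 two_movers2.
- exact: two_movers_static.
Qed.

Lemma replace_two_movers s t s' :
  replace (two_movers s t) mover1 s' = two_movers s' t.
Proof.
apply: funext => i; rewrite /replace.
have [->|i1] := eqVneq i mover1; first by rewrite two_movers1.
have [->|i2] := eqVneq i mover2; first by rewrite !two_movers2.
exact: two_movers_static.
Qed.

(** The smallest gap is the one between the movers when they are near, and the static gap of length
    1 when they are far. *)
Lemma stable_two_movers g s t : 1 <= g -> g < 2 -> base <= s -> base <= t ->
  gap_ok g s t -> stable k.+3 g (two_movers s t).
Proof.
move=> g1 g2.
wlog st : s t / s <= t.
  move=> H Bs Bt ok; have [st|/ltW ts] := lerP s t; first exact: H.
  rewrite -two_movers_swap; apply: stable_perm; apply: H => //.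
  exact/gap_okC.
move=> Bs Bt; rewrite /gap_ok distrC ger0_norm ?subr_ge0 // => -[near|far].
  apply: (@stable_mingap R g h k.+3 k.+3) => //; first lia.
    by rewrite pos_gap_movers subr_ge0.
  by move=> j; exact: pos_mingap_near.
apply: (@stable_mingap R g h k.+3 1) => //; first by rewrite pos_gap1.
by move=> j; exact: pos_mingap_far.
Qed.

(** * The facility rule of a mechanism with bounded ratio *)

Section Mechanism.
Variables (g rho : R) (M : mechanism R (h + k.+3).+1 k.+3).
Hypotheses (g_ge1 : 1 <= g) (g_lt2 : g < 2) (rho_ge0 : 0 <= rho).
Hypothesis anonM : anonymous M.
Hypothesis spM : strategyproof_stable g M.
Hypothesis ratioM : ratio_bounded_by g M rho.

Definition facility_rule s t z : Prop := exists l, M (two_movers s t) l = z.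

Lemma facility_rule_sym : symmetric_rule facility_rule.
Proof. by move=> s t z [l <-]; exists l; rewrite -two_movers_swap anonM. Qed.

Lemma facility_rule_near s t x : exists2 z, facility_rule s t z &
  fdist x (M (two_movers s t)) = `|x - z|.
Proof.
have [l e] := fdist_attained x (M (two_movers s t)) (ltn0Sn _).
by exists (M (two_movers s t) l) => //; exists l.
Qed.

Lemma facility_rule_sp hi : sp_on g base hi facility_rule.
Proof.
move=> s s' t z' /andP[Bs _] /andP[Bs' _] /andP[Bt _] ok ok' [l <-].
have [z Fz e] := facility_rule_near s t s; exists z => //.
rewrite -e; apply: le_trans (fdist_le _ _ l).
have := spM (x := two_movers s t) (i := mover1) (y := s').
rewrite replace_two_movers two_movers1; apply; exact: stable_two_movers.
Qed.

(** The optimum is the smallest gap, here [t - s]; for far movers it is 1. *)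
Lemma cost_near s t : base <= s -> s <= t -> g * (t - s) < 1 ->
  social_cost (two_movers s t) (M (two_movers s t)) <= rho * (t - s).
Proof.
move=> Bs st gts.
have gap0 : 0 <= pos s t k.+3 - pos s t k.+3.-1 by rewrite pos_gap_movers subr_ge0.
have gapm j : (0 < j <= k.+3)%N -> j != k.+3 ->
    pos s t k.+3 - pos s t k.+3.-1 < pos s t j - pos s t j.-1.
  move=> hj jn; apply: le_lt_trans (pos_mingap_near g_ge1 Bs gts hj jn).
  by rewrite ler_peMl.
rewrite -pos_gap_movers -(@social_cost_skip R h k.+3 k.+3 (pos s t)) //.
apply: ratioM; last exact: opt_skip.
apply: stable_two_movers => //; first exact: le_trans st.
by apply: (gap_ok_near (b := t - s)) => //; exact: le_trans g_ge1.
Qed.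

Lemma cost_far s t : base <= s -> s <= t -> g < t - s ->
  social_cost (two_movers s t) (M (two_movers s t)) <= rho.
Proof.
move=> Bs st gts.
have gap0 : 0 <= pos s t 1 - pos s t 1.-1 by rewrite pos_gap1.
have gapm j : (0 < j <= k.+3)%N -> j != 1%N ->
    pos s t 1 - pos s t 1.-1 < pos s t j - pos s t j.-1.
  move=> hj jn; apply: le_lt_trans (pos_mingap_far g_lt2 Bs gts hj jn).
  by rewrite pos_gap1 mulr1.
rewrite -[rho]mulr1 -[X in rho * X](pos_gap1 s t).
rewrite -(@social_cost_skip R h k.+3 1 (pos s t)) //.
apply: ratioM; last exact: opt_skip.
apply: stable_two_movers => //; first exact: le_trans st.
exact: gap_ok_far.
Qed.

Lemma facility_rule_diag s : base <= s -> facility_rule s s s.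
Proof.
move=> Bs; have [z Fz e] := facility_rule_near s s s.
suff sz : s = z by rewrite -sz in Fz.
have := @cost_near s s Bs (lexx _); rewrite subrr !mulr0 => /(_ ltr01) c0.
have := le_trans (fdist_le_cost _ _ mover1) c0; rewrite two_movers1 e.
by rewrite normr_le0 subr_eq0 => /eqP.
Qed.

Lemma facility_rule_far s t : base <= s -> base <= t -> g < `|s - t| ->
  exists2 z, facility_rule s t z & `|s - z| <= rho.
Proof.
move=> Bs Bt; have [ts|st] := lerP t s => gst.
  have [z Fz e] := facility_rule_near t s s.
  exists z; first exact: facility_rule_sym.
  rewrite -e; apply: le_trans (cost_far Bt ts gst).
  by rewrite -{1}(two_movers2 t s); exact: fdist_le_cost.
have [z Fz e] := facility_rule_near s t s; exists z => //.
rewrite -e; apply: le_trans (cost_far Bs (ltW st) gst).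
by rewrite -{1}(two_movers1 s t); exact: fdist_le_cost.
Qed.

(* Each of the [k.+2] static positions attracts its own facility, so only one facility
   is left for the movers. *)
Lemma facility_rule_uniq s t z z' : base <= s -> s <= t ->
  t < s + (2 * (rho + 1))^-1 ->
  facility_rule s t z -> facility_rule s t z' -> base - 1 <= z -> base - 1 <= z' ->
  z = z'.
Proof.
move=> Bs st tw [l <-] [l' <-] Bz Bz'.
have [->//|ll'] := eqVneq l l'; exfalso.
set c := M (two_movers s t) in Bz Bz' *.
have rho0 := rho_ge0; have g2 := g_lt2.
(* The bound on [t - s] brings the cost below one half: each static position has a facility within
   one half, and positions at least 1 apart cannot share it. *)
have small : rho * (t - s) < 2^-1.
  have w2 : 0 < 2 * (rho + 1) by lra.
  have : (t - s) * (2 * (rho + 1)) < 1.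
    by rewrite -ltr_pdivlMr // mul1r; lra.
  by nra.
have gts : g * (t - s) < 1.
  have : (2 * (rho + 1))^-1 <= 2^-1 by rewrite lef_pV2 ?posrE; lra.
  by nra.
have cost := cost_near Bs st gts.
have ex (j : 'I_k.+2) : exists l, `|(j.*2.-1)%:R - c l| < 2^-1.
  have [a e] := fdist_attained ((j.*2.-1)%:R) c (ltn0Sn _).
  exists a; rewrite -e; apply: le_lt_trans small; apply: le_trans cost.
  rewrite -(pos_static s t (ltn_ord j)) -(@spread_rep _ h k.+3 (pos s t) j);
    last exact: leqW (ltnW (ltn_ord j)).
  exact: fdist_le_cost.
pose phi j := xchoose (ex j).
have phiP (j : 'I_k.+2) : `|(j.*2.-1)%:R - c (phi j)| < 2^-1 := xchooseP (ex j).
have phi_inj : injective phi.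
  move=> i j e; apply: ord_inj.
  have := phiP i; have := phiP j; rewrite e !ltr_distlC => /andP[a1 a2] /andP[b1 b2].
  have ij : (i.*2.-1)%:R < (j.*2.-1 + 1)%:R :> R by rewrite natrD; lra.
  have ji : (j.*2.-1)%:R < (i.*2.-1 + 1)%:R :> R by rewrite natrD; lra.
  rewrite ltr_nat in ij.
  rewrite ltr_nat in ji.
  clear -ij ji.
  lia.
have phi_lt j : c (phi j) < base - 1.
  have := phiP j; rewrite ltr_distlC => /andP[_].
  have := static_le_base (ltn_ord j); lra.
have notin a : base - 1 <= c a -> a \notin map phi (enum 'I_k.+2).
  by move=> Ba; apply/mapP => -[j _ e]; have := phi_lt j; rewrite -e; lra.
(* With [l] and [l'] there would be [k.+4] distinct indices among [k.+3]. *)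
have : uniq (l :: l' :: map phi (enum 'I_k.+2)).
  by rewrite /= inE negb_or ll' !notin // map_inj_uniq // enum_uniq.
move=> /card_uniqP /= card_eq.
have := max_card (mem (l :: l' :: map phi (enum 'I_k.+2))).
rewrite card_eq size_map size_enum_ord card_ord; clear; lia.
Qed.

End Mechanism.
End TwoMovers.

(** * From two movers to arbitrary [n] and [k] *)

Lemma no_bounded_anonymous_sp (R : realType) h k (g rho : R)
    (M : mechanism R (h + k.+3).+1 k.+3) :
  1 <= g -> g * g < 2 -> 0 <= rho ->
  anonymous M -> strategyproof_stable g M -> ~ ratio_bounded_by g M rho.
Proof.
move=> g1 g2 rho0 anonM spM ratioM.
have g_lt2 : g < 2 by nra.
have w_gt0 : 0 < (2 * (rho + 1))^-1 by rewrite invr_gt0; lra.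
have w_le : (2 * (rho + 1))^-1 <= 2^-1 by rewrite lef_pV2 ?posrE; lra.
apply: (@no_two_agent_rule R g rho (2 * (rho + 1))^-1 (base R k) (facility_rule M)) => //.
- lra.
- nra.
- exact: facility_rule_sym.
- exact: facility_rule_sp.
- exact: (facility_rule_diag (g := g) (rho := rho)).
- by move=> s t; apply: facility_rule_far.
- by move=> s t z z'; apply: (facility_rule_uniq (g := g)).
Qed.

Unset Implicit Arguments.

Theorem theorem3 (R : realType) (n k : nat) (delta : R) :
  (3 <= k)%N -> (k.+1 <= n)%N -> 0 < delta -> 1 <= Num.sqrt 2 - delta ->
  forall M : mechanism R n k,
    anonymous M -> strategyproof_stable (Num.sqrt 2 - delta) M ->
    ~ (exists rho : R, ratio_bounded_by (Num.sqrt 2 - delta) M rho).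
Proof.
case: k => [|[|[|k]]] // _ kn delta0 g1 M anonM spM [rho ratioM].
(* [k] is now three less than the number of facilities; the [n - k.+4] surplus agents join the first
   position. *)
have en : n = (n - k.+4 + k.+3).+1 by lia.
move: M anonM spM ratioM; rewrite en; move: (n - k.+4)%N => h M anonM spM ratioM.
have s2 : Num.sqrt 2 * Num.sqrt 2 = 2 :> R by rewrite -expr2 sqr_sqrtr.
have g2 : (Num.sqrt 2 - delta) * (Num.sqrt 2 - delta) < 2 :> R by nra.
(* A negative ratio may be raised to 0, since costs are nonnegative. *)
have rho0 : 0 <= Num.max rho 0 by rewrite le_max lexx orbT.
apply: (no_bounded_anonymous_sp g1 g2 rho0 anonM spM) => x xst c copt.
apply: le_trans (ratioM x xst c copt) _; apply: ler_wpM2r; last by rewrite le_max lexx.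
by apply: sumr_ge0 => i _; exact: fdist_ge0.
Qed.
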